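(* Let $(\mathcal{E},\|\cdot\|)$ be a Banach space, let $\sim$ be a relation on $\mathcal{E}$ with property $(D)$, and let $K$ be a nonempty subset of $\mathcal{E}$. Assume that: (1) there is a constant $k>0$ such that $\|x+y\|\geq k\|x\|$ for all $x,y\in\mathcal{E}$ with $x\sim y$; (2) $K$ is a cone; (3) if $x,y\in\mathcal{E}$ are such that $x+y\in K$ and $x\sim y$, then $x,y\in K$; (4) there is an infinite sequence $\{x_n\}_{n=1}^\infty\subseteq\mathcal{E}\setminus K$ such that $x_m\sim x_n$ for all distinct $m,n\in\mathbb{N}$. Then $\mathcal{E}\setminus K$ is spaceable in $\mathcal{E}$.
   Context: A relation $\sim$ on a topological vector space $\mathcal{E}$ has property $(D)$ if the following two conditions hold: (i) if $(x_n)$ is a sequence in $\mathcal{E}$ such that $x_n\sim x_m$ for all distinct indices $m,n$, then for all disjoint finite subsets $A,B$ of $\mathbb{N}$ and arbitrary scalars $\alpha_n$ ($n\in A$), $\beta_m$ ($m\in B$), we have $\sum_{n\in A}\alpha_nx_n\sim\sum_{m\in B}\beta_mx_m$; (ii) if a sequence $(x_n)$ converges to $x$ in $\mathcal{E}$ and for some $y\in\mathcal{E}$ we have $x_n\sim y$ for all $n\in\mathbb{N}$, then $x\sim y$. A subset $B$ of a vector space is called a cone if $cB\subseteq B$ for each scalar $c$. A subset $S$ of a Banach space $Y$ is called spaceable in $Y$ if $S\cup\{0\}$ contains a closed infinite-dimensional linear subspace of $Y$. *)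

(* Defs.v *)
From HB Require Import structures.
From mathcomp Require Import all_boot all_order all_algebra finmap.
From mathcomp Require Import all_classical all_reals all_analysis.
From mathcomp Require Import complex.

Set Implicit Arguments.
Unset Strict Implicit.
Unset Printing Implicit Defensive.

Import Order.TTheory GRing.Theory Num.Theory.
Import numFieldNormedType.Exports.

Local Open Scope classical_set_scope.
Local Open Scope ring_scope.

(* The scalar field of a vector space is the field of real or of complex
   numbers.  Norms on a [normedModType] over [R[i]] take values in [R[i]], whose
   order is such that [0 <= z] and [0 < z] imply that [z] is real. *)
Variant scalar_kind := RealScalars | ComplexScalars.

Definition scalar_field (R : realType) (s : scalar_kind) : numFieldType :=
  match s with
  | RealScalars => R
  | ComplexScalars => R[i]
  end.

(* [topologicalLmodType] is the type of general topological vector spaces;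
   [tvsType] would in addition impose local convexity. *)
Definition property_D (F : numFieldType) (E : topologicalLmodType F)
    (r : E -> E -> Prop) : Prop :=
  (forall x : nat -> E,
      (forall m n : nat, m <> n -> r (x n) (x m)) ->
      forall (A B : {fset nat}) (alpha beta : nat -> F),
        [disjoint A & B]%fset ->
        r (\sum_(n <- A) alpha n *: x n) (\sum_(m <- B) beta m *: x m))
  /\
  (forall (x : nat -> E) (l y : E),
      x @ \oo --> l -> (forall n : nat, r (x n) y) -> r l y).

Definition is_cone (F : numFieldType) (E : lmodType F) (B : set E) : Prop :=
  forall (c : F) (x : E), B x -> B (c *: x).

Definition finite_dimensional (F : numFieldType) (E : lmodType F) (V : set E)
    : Prop :=
  exists (n : nat) (b : 'I_n -> E),
    (forall i, V (b i)) /\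
    (forall v, V v -> exists a : 'I_n -> F, v = \sum_(i < n) a i *: b i).

Definition spaceable (F : numFieldType) (Y : completeNormedModType F)
    (S : set Y) : Prop :=
  exists V : set Y,
    [/\ GRing.submod_closed (mem V), closed V, ~ finite_dimensional V
      & V `<=` S `|` [set 0]].

(* Main.v *)
(* Let [V] be the closed linear span of the [x n].  Disjointly supported
   combinations of the [x n] are related, so (1) bounds every partial sum of a
   finite combination by a fixed multiple of the norm of that combination; in
   particular the coefficient functionals are bounded on the span.  Hence if [v]
   is a limit of finite combinations, the coefficients at [n] converge to some
   [c n], and passing to the limit in the first argument of the relation gives
   [v - c n *: x n ~ c n *: x n].  If [v] lies in [K], so does [c n *: x n] by
   (3), which forces [c n = 0] because [K] is a cone missing [x n].  When all
   [c n] vanish, the bound on partial sums yields [v = 0].  Completeness is only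
   needed for the scalars. *)

Require Import Defs.
From HB Require Import structures.
From mathcomp Require Import all_boot all_order all_algebra finmap.
From mathcomp Require Import all_classical all_reals all_analysis.
From mathcomp Require Import complex.
Import Order.TTheory GRing.Theory Num.Theory.
Import numFieldNormedType.Exports.
Local Open Scope classical_set_scope.
Local Open Scope ring_scope.

Set Implicit Arguments.
Unset Strict Implicit.
Unset Printing Implicit Defensive.

(** * Archimedean property and completeness of the scalars *)

(** A positive complex number is real, so both cases reduce to the archimedean property of [R]. *)
Lemma scalar_archimedean (R : realType) (s : scalar_kind) (e : scalar_field R s) :
  0 < e -> exists N : nat, forall n, (N <= n)%N -> n.+1%:R^-1 < e.
Proof.
have H (a : R) : 0 < a -> exists N : nat, forall n, (N <= n)%N -> n.+1%:R^-1 < a.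
  move=> a0; have [N _ HN] := near_infty_natSinv_lt (PosNum a0).
  by exists N => n; exact: HN.
case: s e => [|]; first exact: H.
case=> a b; rewrite [_ < _]ltcE /= => /andP[/eqP -> /H[N HN]].
exists N => n /HN; rewrite -ltcR.
by rewrite fmorphV rmorph_nat.
Qed.

Lemma real_cauchy_cvg (R : realType) (u : nat -> R) :
  (forall e, 0 < e -> exists N : nat, forall m n : nat,
     (N <= m)%N -> (N <= n)%N -> `|u m - u n| < e) ->
  cvg (u @ \oo).
Proof.
move=> cu; apply: cauchy_cvg; apply: cauchy_exP => e e0.
have [N HN] := cu e e0; exists (u N); exists N => // n /= Nn.
by rewrite -ball_normE /=; exact: HN.
Qed.

Lemma scalar_cauchy_cvg (R : realType) (s : scalar_kind)
    (u : nat -> scalar_field R s) :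
  (forall e, 0 < e -> exists N : nat, forall m n : nat,
     (N <= m)%N -> (N <= n)%N -> `|u m - u n| < e) ->
  exists l : scalar_field R s, u @ \oo --> l.
Proof.
case: s u => [u /real_cauchy_cvg cu|u cu]; first by exists (lim (u @ \oo)).
(* An additive map dominated by the modulus preserves Cauchy sequences; this is applied to the real
   and imaginary parts. *)
have part (f : R[i] -> R) : {morph f : x y / x - y} ->
    (forall z, (`|f z|%:C)%C <= `|z|) -> cvg ((f \o u) @ \oo).
  move=> fB f_le; apply: real_cauchy_cvg => e e0.
  have [|N HN] := cu (e%:C)%C; first by rewrite ltcR.
  exists N => m n Nm Nn; rewrite -ltcR /= -fB.
  exact: le_lt_trans (f_le _) (HN _ _ Nm Nn).
have cRe := part (@complex.Re R) (fun x y => raddfB _ x y) (@normc_ge_Re R).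
have cIm : cvg ((@complex.Im R \o u) @ \oo).
  apply: part => [x y|z]; first exact: raddfB.
  case: z => a b; rewrite normc_def /= lecR -sqrtr_sqr ler_wsqrtr //.
  by rewrite lerDr sqr_ge0.
set a := lim ((@complex.Re R \o u) @ \oo) in cRe.
set b := lim ((@complex.Im R \o u) @ \oo) in cIm.
have norm_real (t : R) : `|(t%:C)%C| = (`|t|%:C)%C.
  by rewrite normc_def /= expr0n addr0 sqrtr_sqr.
exists (a +i* b)%C; apply/(@cvgrPdist_lt _ (R[i] : numFieldType)) => e.
case: e => d d'; rewrite ltcE /= => /andP[/eqP -> d0].
have d20 : 0 < d / 2 by rewrite divr_gt0.
move/cvgrPdist_lt : cRe => /(_ _ d20) HRe.
move/cvgrPdist_lt : cIm => /(_ _ d20) HIm.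
near=> n.
have -> : (a +i* b)%C - u n =
    ((a - complex.Re (u n))%:C + 'i * (b - complex.Im (u n))%:C)%C.
  by case: (u n) => x y; simpc.
rewrite (le_lt_trans (ler_normD _ _)) // normrM normCi mul1r !norm_real.
rewrite -rmorphD /= ltcR [d]splitr ltrD //; near: n; [exact: HRe|exact: HIm].
Unshelve. all: by end_near.
Qed.

(** * Finite linear combinations *)

Section Lincomb.
Variables (F : numFieldType) (E : lmodType F) (x : nat -> E).
Implicit Types p q : {poly F}.

(* Polynomials serve as the finitely supported sequences of coefficients. *)
Definition lincomb p : E := \sum_(i < size p) p`_i *: x i.

(** Padding with zero coefficients allows polynomials of different sizes to be summed over a common
    range. *)
Lemma lincombE N p : (size p <= N)%N -> lincomb p = \sum_(i < N) p`_i *: x i.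
Proof.
move=> pN; rewrite /lincomb (big_ord_widen _ (fun i => p`_i *: x i) pN).
rewrite big_mkcond; apply: eq_bigr => i _.
by case: ltnP => // /(nth_default 0) ->; rewrite scale0r.
Qed.

Lemma lincomb_linear : linear lincomb.
Proof.
move=> a p q; pose N := maxn (size (a *: p + q)) (maxn (size p) (size q)).
rewrite !(@lincombE N) ?leq_max ?leqnn ?orbT //.
rewrite scaler_sumr -big_split /=; apply: eq_bigr => i _.
by rewrite coefD coefZ scalerDl scalerA.
Qed.

Lemma lincombB p q : lincomb (p - q) = lincomb p - lincomb q.
Proof.
have := lincomb_linear (-1) q p.
by rewrite !scaleN1r ![- _ + _]addrC.
Qed.

(** The bound [maxn n.+1 (size p)] makes [n] a summation index even when [n] lies beyond the support
    of [p]. *)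
Lemma lincombB1 n p :
  lincomb p - p`_n *: x n =
    \sum_(i < maxn n.+1 (size p) | i != n :> nat) p`_i *: x i.
Proof.
rewrite (@lincombE (maxn n.+1 (size p))) ?leq_maxr //.
have nN : (n < maxn n.+1 (size p))%N by rewrite leq_max ltnS leqnn.
rewrite (bigD1 (Ordinal nN)) //= addrAC subrr add0r.
exact: eq_bigl.
Qed.

End Lincomb.

Lemma lincombX (F : numFieldType) (E : lmodType F) (x : nat -> E) n :
  lincomb x 'X^n = x n.
Proof.
rewrite /lincomb size_polyXn big_ord_recr /= coefXn eqxx scale1r big1 ?add0r //.
by move=> i _; rewrite coefXn ltn_eqF // scale0r.
Qed.

(** * Related sums, closures and dimension *)

(** Condition (i) of property (D), with the finite index sets cut out of initial segments by
    disjoint predicates. *)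
Lemma property_D_sums (F : numFieldType) (E : topologicalLmodType F)
    (r : E -> E -> Prop) (x : nat -> E) (P Q : pred nat) (N M : nat)
    (a b : nat -> F) :
  property_D r -> (forall m n : nat, m <> n -> r (x m) (x n)) ->
  (forall i, P i -> ~~ Q i) ->
  r (\sum_(i < N | P i) a i *: x i) (\sum_(i < M | Q i) b i *: x i).
Proof.
move=> [rD _] rx PQ.
pose S L (T : pred nat) := [fset i in iota 0 L | T i]%fset.
have sumE L (T : pred nat) (c : nat -> F) :
    \sum_(i <- S L T) c i *: x i = \sum_(i < L | T i) c i *: x i.
  rewrite -(big_mkord T (fun i => c i *: x i)) -big_filter.
  apply: perm_big; apply: uniq_perm; rewrite ?fset_uniq ?filter_uniq ?iota_uniq //.
  by move=> i; rewrite !inE mem_filter mem_index_iota mem_iota andbC.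
rewrite -!sumE; apply: rD => [m n mn|]; first by apply: rx => nm; apply: mn.
apply/fdisjointP => i; rewrite !inE => /andP[_ /PQ /negPf ->].
by rewrite andbF.
Qed.

(** The radii [e] are a parameter because [F] need not be archimedean. *)
Lemma closure_seq (F : numFieldType) (E : normedModType F) (S : set E) (v : E)
    (e : nat -> F) :
  (forall n, 0 < e n) ->
  (forall d, 0 < d -> exists N, forall n, (N <= n)%N -> e n < d) ->
  closure S v -> exists2 u : nat -> E, (forall n, S (u n)) & u @ \oo --> v.
Proof.
move=> e0 e_small Sv.
have /choice[u uP] n : exists y, S y /\ `|v - y| < e n.
  have [y [Sy]] := Sv _ (nbhsx_ballx v _ (e0 n)).
  by rewrite -ball_normE /= => vy; exists y.
exists u => [n|]; first by case: (uP n).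
apply/cvgrPdist_lt => d /e_small[N HN]; exists N => // n /= /HN.
by apply: lt_trans; case: (uP n).
Qed.

Lemma submod_closed_closure (F : numFieldType) (E : normedModType F) (S : set E) :
  GRing.submod_closed (mem S) -> GRing.submod_closed (mem (closure S)).
Proof.
move=> [S0 SD]; split.
  by rewrite inE; apply: subset_closure; move: S0; rewrite inE.
move=> a u v; rewrite !inE => Su Sv B.
have cont : (fun z : E * E => a *: z.1 + z.2) @ (nbhs u, nbhs v) --> a *: u + v.
  apply: cvgD; last exact: cvg_snd.
  apply: cvgZ; [exact: cvg_cst|exact: cvg_fst].
move=> /cont [[A1 A2] /= [A1u A2v] A12].
have [y [Sy A1y]] := Su _ A1u; have [z [Sz A2z]] := Sv _ A2v.
exists (a *: y + z); split; last exact: (A12 (y, z)).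
by have := SD a y z; rewrite !inE; apply.
Qed.

(** If [n] vectors spanned [V], the coordinates of [n.+1] of the [x i] would form a matrix with a
    nonzero left kernel, and a kernel row is a linear dependence among the [x i]. *)
Lemma free_not_finite_dimensional (F : numFieldType) (E : lmodType F)
    (V : set E) (x : nat -> E) :
  (forall n, V (x n)) ->
  (forall (N : nat) (a : nat -> F), \sum_(i < N) a i *: x i = 0 ->
     forall i, (i < N)%N -> a i = 0) ->
  ~ finite_dimensional V.
Proof.
move=> Vx free_x [n [b [_ b_span]]].
have /choice[A AE] i := b_span _ (Vx i).
pose M : 'M[F]_(n.+1, n) := \matrix_(i, j) A i j.
have : kermx M != 0.
  rewrite kermx_eq0; apply/negP => /eqP rM.
  by have := rank_leq_col M; rewrite rM ltnn.
case/rowV0Pn => w /sub_kermxP wM /negP; apply; apply/eqP/rowP => i; rewrite mxE.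
have := free_x n.+1 (fun i => w 0 (inord i)) _ i (ltn_ord i).
rewrite inord_val; apply.
under eq_bigr => k _ do rewrite inord_val AE scaler_sumr.
rewrite exchange_big big1 // => j _.
under eq_bigr => k _ do rewrite scalerA.
rewrite -scaler_suml; move/rowP/(_ j) : wM; rewrite !mxE => wMj.
transitivity ((\sum_k w 0 k * M k j) *: b j); last by rewrite wMj scale0r.
by congr (_ *: _); apply: eq_bigr => k _; rewrite mxE.
Qed.

(** * Coefficient bounds and limits of combinations *)

Section BasicSequence.
Variables (F : numFieldType) (E : normedModType F) (r : E -> E -> Prop).
Variables (x : nat -> E) (k : F).
Hypothesis rD : property_D r.
Hypothesis rx : forall m n : nat, m <> n -> r (x m) (x n).
Hypothesis k_gt0 : 0 < k.
Hypothesis r_norm : forall u v : E, r u v -> k * `|u| <= `|u + v|.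
Hypothesis x_neq0 : forall n, x n != 0.

(** The terms inside and outside [P] have related sums, so [r_norm] applies: coordinate projections
    on the span are bounded by [k^-1], as for an unconditional basic sequence. *)
Lemma norm_subsum_le (P : pred nat) (N : nat) (a : nat -> F) :
  k * `|\sum_(i < N | P i) a i *: x i| <= `|\sum_(i < N) a i *: x i|.
Proof.
rewrite [X in _ <= `|X|](bigID (fun i : 'I_N => P i)) /=.
apply: r_norm; apply: (@property_D_sums _ _ r x P (predC P) N N a a rD rx) => i Pi.
by rewrite /= negbK.
Qed.

Lemma norm_partial_sum_le n (p : {poly F}) :
  k * `|\sum_(i < n) p`_i *: x i| <= `|lincomb x p|.
Proof.
rewrite (@lincombE _ _ _ (maxn n (size p))) ?leq_maxr //.
rewrite (big_ord_widen _ (fun i => p`_i *: x i) (leq_maxl n (size p))).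
exact: (norm_subsum_le (fun i => (i < n)%N)).
Qed.

Lemma norm_coef_le n (p : {poly F}) : k * `|p`_n *: x n| <= `|lincomb x p|.
Proof.
have nN : (n < maxn n.+1 (size p))%N by rewrite leq_max ltnS leqnn.
rewrite (@lincombE _ _ _ (maxn n.+1 (size p))) ?leq_maxr //.
have := norm_subsum_le (pred1 n) (maxn n.+1 (size p)) (fun i => p`_i).
by rewrite (big_pred1 (Ordinal nN)).
Qed.

Lemma lincomb_free (N : nat) (a : nat -> F) :
  \sum_(i < N) a i *: x i = 0 -> forall i, (i < N)%N -> a i = 0.
Proof.
move=> a0 i iN; have := norm_subsum_le (pred1 i) N a.
rewrite (big_pred1 (Ordinal iN)) // a0 normr0 pmulr_rle0 // normr_le0.
by rewrite scaler_eq0 (negPf (x_neq0 i)) orbF => /eqP.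
Qed.

Section LimitOfCombinations.
Variables (p : nat -> {poly F}) (v : E).
Hypothesis pv : lincomb x (p j) @[j --> \oo] --> v.

Lemma coef_cauchy n (e : F) : 0 < e -> exists N : nat, forall i j : nat,
  (N <= i)%N -> (N <= j)%N -> `|(p i)`_n - (p j)`_n| < e.
Proof.
(* By [norm_coef_le], [c] times the modulus of the [n]-th coefficient is at most the norm of the
   combination. *)
move=> e0; pose c := k * `|x n|.
have c0 : 0 < c by rewrite mulr_gt0 // normr_gt0.
have d0 : 0 < c * e / 2 by rewrite divr_gt0 // mulr_gt0.
move/cvgrPdist_lt : pv => /(_ _ d0)[N _ HN].
exists N => i j Ni Nj; rewrite -(ltr_pM2l c0).
have := norm_coef_le n (p i - p j).
rewrite normrZ coefB mulrCA mulrC -/c => /le_lt_trans; apply.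
rewrite lincombB -(subrKA v) [c * e]splitr.
rewrite (le_lt_trans (ler_normD _ _)) // ltrD //; last exact: HN.
by rewrite distrC; exact: HN.
Qed.

(** Without its [n]-th term, [lincomb x (p j)] is supported off [n], hence related to [c *: x n].
    The second argument is fixed at its limit value since condition (ii) varies only the first. *)
Lemma limit_split_related n (c : F) :
  (p j)`_n @[j --> \oo] --> c -> r (v - c *: x n) (c *: x n).
Proof.
move=> pc.
apply: (proj2 rD (fun j => lincomb x (p j) - (p j)`_n *: x n)) => [|j].
  apply: cvgB => //; apply: cvgZ => //; exact: cvg_cst.
rewrite lincombB1.
have -> : c *: x n = \sum_(i < n.+1 | (i : nat) == n) c *: x i.
  by rewrite (big_pred1 ord_max).
exact: (@property_D_sums _ _ r x (predC1 n) (pred1 n) _ _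
  (fun i => (p j)`_i) (fun=> c) rD rx).
Qed.

(** Fix [q := p N] close to [v], and let [S] be the part of a later [p j] on the indices below
    [size q]. Then [S] is small, and [lincomb x q - S] is a partial sum of [q - p j], so it is small
    too. *)
Lemma limit_coef0_eq0 :
  (forall n, (p j)`_n @[j --> \oo] --> (0 : F)) -> v = 0.
Proof.
move=> p0; apply/eqP; rewrite -normr_le0 -(pmulr_rle0 _ k_gt0).
(* With all errors below [e / C], the pieces [v - lincomb x q], [lincomb x q - S] and [S],
   multiplied by [k], cost [k], [1 + 1] and [k] times [e / C]. *)
pose C := k + (1 + (1 + k)).
have C0 : 0 < C by rewrite !addr_gt0.
apply/ler_addgt0Pr => e e0; rewrite add0r.
have d0 : 0 < e / C by rewrite divr_gt0.
move/cvgrPdist_lt : pv => /(_ _ d0)[N _ HN].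
pose q := p N.
(* The range [size q] does not depend on [j], so coefficientwise convergence suffices. *)
have q0 : \sum_(i < size q) (p j)`_i *: x i @[j --> \oo] --> (0 : E).
  rewrite [X in _ --> X](_ : _ = \sum_(i < size q) 0 *: x i); last first.
    by rewrite big1 // => i _; rewrite scale0r.
  apply: (cvg_big (@add_continuous E)) => i _.
  by apply: cvgZ; [exact: p0|exact: cvg_cst].
move/cvgrPdist_lt : q0 => /(_ _ d0)[M _ HM].
pose j := maxn N M.
have vq : `|v - lincomb x q| < e / C by apply: HN => /=.
have vj : `|v - lincomb x (p j)| < e / C by apply: HN => /=; exact: leq_maxl.
have := HM j (leq_maxr _ _); rewrite /= sub0r normrN => Sj.
have Sq : k * `|lincomb x q - \sum_(i < size q) (p j)`_i *: x i| <= e / C + e / C.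
  have := norm_partial_sum_le (size q) (q - p j).
  under eq_bigr => i _ do rewrite coefB scalerBl.
  rewrite sumrB => /le_trans; apply.
  rewrite lincombB -(subrKA v) (le_trans (ler_normD _ _)) // lerD //.
    by rewrite distrC ltW.
  exact: ltW.
have -> : e = k * (e / C) + (e / C + (e / C + k * (e / C))).
  by rewrite -[X in _ + (X + (X + _))]mul1r -!mulrDl mulrC divfK // gt_eqF.
set S := \sum_(i < _) _ in Sj Sq.
have -> : v = (v - lincomb x q) + ((lincomb x q - S) + S).
  by rewrite subrK subrK.
rewrite (le_trans (ler_wpM2l (ltW k_gt0) (ler_normD _ _))) // mulrDr.
rewrite lerD //; first by rewrite ler_wpM2l ?ltW.
rewrite (le_trans (ler_wpM2l (ltW k_gt0) (ler_normD _ _))) // mulrDr addrA.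
by rewrite lerD // ler_wpM2l ?ltW.
Qed.

End LimitOfCombinations.
End BasicSequence.

(** * Spaceability of the complement of the cone *)

Theorem theorem4p2 (R : realType) (s : scalar_kind)
    (E : completeNormedModType (scalar_field R s))
    (r : E -> E -> Prop) (K : set E)
    (rD : property_D r)
    (K_nonempty : K !=set0)
    (h1 : exists2 k : scalar_field R s, 0 < k &
            forall x y : E, r x y -> k * `|x| <= `|x + y|)
    (h2 : is_cone K)
    (h3 : forall x y : E, K (x + y) -> r x y -> K x /\ K y)
    (h4 : exists x : nat -> E,
            (forall n : nat, ~ K (x n)) /\
            (forall m n : nat, m <> n -> r (x m) (x n))) :
  spaceable (~` K).
Proof.
have [k k0 r_norm] := h1; have [x [Kx rx]] := h4.
(* A nonempty cone contains [0], while [x n] lies outside [K]. *)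
have x_neq0 n : x n != 0.
  apply/eqP => xn0; have [y Ky] := K_nonempty.
  by apply: (Kx n); rewrite xn0 -(scale0r y); exact: h2.
exists (closure (range (lincomb x))); split.
- apply: submod_closed_closure; split.
    by rewrite inE; exists 0 => //; rewrite /lincomb size_poly0 big_ord0.
  move=> a y z; rewrite !inE => -[p _ <-] [q _ <-].
  by exists (a *: p + q) => //; exact: lincomb_linear.
- exact: closed_closure.
- apply: (@free_not_finite_dimensional _ _ _ x).
    by move=> n; apply: subset_closure; exists 'X^n => //; exact: lincombX.
  exact: (lincomb_free rD rx k0 r_norm x_neq0).
move=> v Vv; have [Kv|] := pselect (K v); last by left.
right.
have [n|d d0|u u_span uv] :=
  @closure_seq _ _ _ _ (fun n => n.+1%:R^-1) _ _ Vv.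
- by rewrite invr_gt0.
- exact: scalar_archimedean.
have /choice[p pu] n : exists q, lincomb x q = u n.
  by have [q _ qu] := u_span n; exists q.
have pv : lincomb x (p j) @[j --> \oo] --> v.
  by rewrite (_ : (fun j => _) = u) //; apply/funext.
apply: (limit_coef0_eq0 rD rx k0 r_norm pv) => n.
have [c pc] := scalar_cauchy_cvg (coef_cauchy rD rx k0 r_norm x_neq0 pv n).
suff c0 : c = 0 by rewrite c0 in pc.
have [//|c_neq0] := eqVneq c 0.
have [_ Kcx] : K (v - c *: x n) /\ K (c *: x n).
  by apply: h3; [rewrite subrK|exact: (limit_split_related rD rx pv pc)].
(* For [c != 0], scaling [c *: x n] by the inverse of [c] would put [x n] in [K]. *)
by case: (Kx n); rewrite -(scalerK c_neq0 (x n)); exact: h2.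
Qed.
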